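(* Let $q$ be a power of an odd prime, $R=\mathbf{F}_q[T]$, $k=\mathbf{F}_q(T)$. Let $P\in R$ be irreducible, $c\in\mathbf{F}_q^\times$, and $G\in R$ with $\deg G\ge 2$. Let $D=(PG)^2+c$, and assume that $D$ is square-free and monic (so $K=k(\sqrt{D})$ is a real quadratic function field). If $(c/P)=1$, then the ideal class number $h(D)$ of $K$ satisfies $$h(D)\ge \frac{\deg(GP)}{\deg P}>1.$$
   Context: The ring of integers $\mathcal{O}_K$ of $K$ is the integral closure of $R=\mathbf{F}_q[T]$ in $K$. The ideal class number $h(D)=h(K)$ is the order of the group of fractional ideals of $\mathcal{O}_K$ modulo principal fractional ideals. For $F\in R$ not divisible by the irreducible polynomial $P$, $(F/P)$ is the quadratic residue symbol: $(F/P)=1$ if $F$ is a quadratic residue modulo $P$, and $(F/P)=-1$ otherwise. *)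

(* Defs.v *)
From mathcomp Require Import all_boot all_order all_algebra all_field.
From mathcomp Require Import finmap.
From mathcomp Require Import mathcomp_extra boolp classical_sets functions cardinality.

Set Implicit Arguments.
Unset Strict Implicit.
Unset Printing Implicit Defensive.

Import Order.TTheory GRing.Theory Num.Theory.

Local Open Scope classical_set_scope.
Local Open Scope ring_scope.

(* The convention deg 0 = 0 is used. *)
Definition deg (R : nzRingType) (p : {poly R}) : nat := (size p).-1.

Definition square_free (F : fieldType) (p : {poly F}) : Prop :=
  forall u : {poly F}, size u != 1%N -> ~~ (u ^+ 2 %| p).

(* The symbol (f / p), extended by 0 to multiples of p. *)
Definition quad_res (F : fieldType) (f p : {poly F}) : int :=
  if p %| f then 0
  else if `[< exists g : {poly F}, p %| f - g ^+ 2 >] then 1 else -1.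

Section ClassNumber.
Variables (R : idomainType) (K : fieldExtType {fraction R}).

Definition base_inj : R -> K := in_alg K \o @tofrac R.

Definition integral_closure : set K := [set x | integralOver base_inj x].

Local Notation O := integral_closure.

Definition fractional_ideal (I : set K) : Prop :=
  [/\ I 0,
      (forall x y, I x -> I y -> I (x + y)),
      (forall a x, O a -> I x -> I (a * x)),
      (exists2 x, I x & x != 0)
    & (exists d, [/\ O d, d != 0 & forall x, I x -> O (d * x)])].

Definition principal_ideal (x : K) : set K := [set a * x | a in O].

(* The product is the set of finite sums of products, not just of products. *)
Definition ideal_mul (I J : set K) : set K :=
  [set z | exists n (a b : 'I_n -> K),
     (forall i, I (a i) /\ J (b i)) /\ z = \sum_(i < n) a i * b i].

(* Coset of I modulo the subgroup of (nonzero) principal fractional ideals. *)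
Definition ideal_class (I : set K) : set (set K) :=
  [set ideal_mul (principal_ideal x) I | x in [set x | x != 0]].

Definition class_group : set (set (set K)) :=
  [set ideal_class I | I in fractional_ideal].

(* fset_set sends an infinite set to the empty fset, so a positive lower bound
   on the class number entails that the class group is finite. *)
Definition class_number : nat := #|` fset_set class_group|%fset.

End ClassNumber.

(* Main.v *)
(** Write M = P G and s = sqrt D, so that D = M^2 + c and M - s is a unit of
    O = F[T] + F[T] s.  If a + b s is in O and its norm has degree < deg M, then
    multiplying it by M - s or M + s lowers deg b; after finitely many steps
    b = 0, and the norm is a constant times a square.  Since c is a square
    modulo P, the prime P splits, and a prime p above P has powers p^k of norm
    P^k.  If p^i and p^j with i < j were equivalent, there would be an element,
    not divisible by P, of norm P^(j-i) up to a constant; this is impossible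
    when (j - i) deg P < deg M.  Hence at least deg M / deg P classes are
    distinct.  Finiteness of the class group is proved by the box principle:
    every class contains an ideal of O containing a fixed nonzero polynomial. *)

Require Import Defs.
From HB Require Import structures.
From mathcomp Require Import all_boot all_order all_algebra all_field.
From mathcomp Require Import generic_quotient finmap.
From mathcomp Require Import boolp classical_sets cardinality.
From mathcomp Require Import ring zify.

Set Implicit Arguments.
Unset Strict Implicit.
Unset Printing Implicit Defensive.

Import Order.TTheory GRing.Theory Num.Theory.
Local Open Scope ring_scope.

(** * Elements of small norm in F[T][sqrt D], for D = M^2 + c *)

Section Pell.
Variables (F : fieldType) (P M : {poly F}) (c : F).
Hypotheses (hP : irreducible_poly P) (hPM : P %| M) (hc : c != 0)
  (two_neq0 : 2%:R != 0 :> F).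

Local Notation D := (M ^+ 2 + c%:P).
(** The norm form of F[T][sqrt d], written on coordinates so that no square root of d has to be
    given. *)
Definition qnorm (d a b : {poly F}) : {poly F} := a ^+ 2 - d * b ^+ 2.
Local Notation N := (qnorm D).

Lemma irredp_dvdM (a b : {poly F}) : (P %| a * b) = (P %| a) || (P %| b).
Proof.
apply/idP/idP => [Pab|/orP[/dvdp_mulr->|/dvdp_mull->]//].
have [//|/= NPa] := boolP (P %| a).
by rewrite -(Gauss_dvdpr b (_ : coprimep P a)) // irreducible_poly_coprime.
Qed.

Lemma irredp_dvdX (a : {poly F}) n : P %| a ^+ n -> P %| a.
Proof.
elim: n => [|n IHn]; last by rewrite exprS irredp_dvdM => /orP[].
by rewrite expr0 dvdp1 => /eqP sP; have := hP.1; rewrite sP.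
Qed.

Lemma irredp_ndvdC (d : F) : d != 0 -> ~~ (P %| d%:P).
Proof.
by move=> d0; apply: contraL hP.1 => /dvdp_leq; rewrite polyC_eq0 size_polyC d0
  -leqNgt => ->.
Qed.

Lemma irredp_ndvdD : ~~ (P %| D).
Proof. by rewrite dvdp_addr ?irredp_ndvdC // exprS dvdp_mulr. Qed.

(** The two terms [v + u] and [v - u] differ by [2 u], so the degree of u cannot cancel in both.
    This settles the sign of b in the descent. *)
Lemma size_scale2_le_max (u v : {poly F}) :
  (size (2%:R *: u)%R <= maxn (size (v + u)%R) (size (v - u)%R))%N.
Proof.
have -> : 2%:R *: u = (v + u) - (v - u) by rewrite scaler_nat; ring.
by rewrite (leq_trans (size_polyD _ _)) // size_polyN.
Qed.

(** The new coordinates are those of [(a + b sqrt D) (M - sqrt D)], and [M - sqrt D] has norm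
    [-c]. *)
Lemma qnorm_unit_mul (a b : {poly F}) :
  N (a * M - D * b) (b * M - a) = - c *: N a b.
Proof. by rewrite /qnorm -mul_polyC rmorphN /=; ring. Qed.

(* Multiplying by the unit M - sqrt D lowers the degree of the coefficient of
   sqrt D as long as the norm has degree less than deg M. *)
Lemma size_descent (a b : {poly F}) : (1 < size M)%N -> b != 0 ->
  (size (N a b) < size M)%N ->
  (size b + size M <= (size (a + b * M)%R).+1)%N ->
  (size (b * M - a)%R < size b)%N.
Proof.
move=> sM b0 sN sab.
have [->|b'0] := eqVneq (b * M - a) 0; first by rewrite size_poly0 size_poly_gt0.
have ab0 : a + b * M != 0.
  by rewrite -size_poly_gt0; move: sab; rewrite -size_poly_gt0 in b0; lia.
have := size_mul b'0 ab0.
(* The product has degree at most the larger of deg N and 2 deg b, while its second factor has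
   degree at least deg b + deg M. *)
have -> : (b * M - a) * (a + b * M) = - (N a b + c *: b ^+ 2).
  by rewrite /qnorm -mul_polyC; ring.
rewrite size_polyN => e.
have := size_polyD (N a b) (c *: b ^+ 2); rewrite e size_scale // (expr2 b) size_mul //.
have := sM; have := sN; have := sab; have := ab0; have := b'0; have := b0.
rewrite -!size_poly_gt0.
move: (size b) (size M) (size (N a b)) (size (a + b * M)) (size (b * M - a)); lia.
Qed.

(** Induction on the size of b: the descent multiplies by a unit, which preserves the size of the
    norm and its divisibility by P, until b = 0 and the norm is [a^2]. *)
Lemma small_qnorm_dvd (a b : {poly F}) : (1 < size M)%N ->
  (size (N a b) < size M)%N -> P %| N a b -> (P %| a) && (P %| b).
Proof.
move=> sM.
have [n] := ubnP (size b); elim: n => // n IHn in a b * => sbn sN PN.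
have [b0|b0] := eqVneq b 0.
  by move: PN; rewrite b0 dvdp0 andbT /qnorm expr0n mulr0 subr0; apply: irredp_dvdX.
(* Conjugation, b to -b, changes neither the norm nor the claim. *)
wlog sab : b sbn sN PN b0 / (size b + size M <= (size (a + b * M)%R).+1)%N.
  move=> H; have [|sab] := leqP (size b + size M)%N (size (a + b * M)%R).+1.
    exact: H.
  have := H (- b); rewrite size_polyN oppr_eq0 dvdpNr /qnorm sqrrN; apply => //.
  have := size_scale2_le_max (b * M) a; rewrite size_scale // size_mul //; last first.
    by rewrite -size_poly_gt0 ltnW.
  rewrite mulNr.
  have := b0; rewrite -size_poly_gt0; move: sab sM.
  move: (size b) (size M) (size (a + b * M)) (size (a - b * M)); lia.
have sb' := size_descent sM b0 sN sab.
have cN : - c != 0 by rewrite oppr_eq0.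
have /andP[] : (P %| a * M - D * b) && (P %| b * M - a).
  apply: IHn.
  - by apply: leq_trans sb' _; rewrite -ltnS.
  - by rewrite qnorm_unit_mul size_scale.
  - by rewrite qnorm_unit_mul dvdpZr.
(* Divisibility is carried back through the unit: P divides M, hence a, hence [D b], and it does not
   divide D. *)
move=> + Pb'; have Pa : P %| a by move: Pb'; rewrite dvdp_subr ?dvdp_mull.
rewrite Pa (dvdp_subr _ (dvdp_mulr M Pa)) irredp_dvdM.
by rewrite (negbTE irredp_ndvdD).
Qed.

(** Zero is a norm of small degree divisible by P, so P could be divided out of a and b
    indefinitely. Thus D is not a square; later sections use this as [hDnsq]. *)
Lemma qnorm_eq0 (a b : {poly F}) : (1 < size M)%N ->
  N a b = 0 -> (a = 0) /\ (b = 0).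
Proof.
move=> sM N0; suff b0 : b = 0.
  split=> //; move: N0; rewrite b0 /qnorm expr0n mulr0 subr0 => /eqP.
  by rewrite expf_eq0 => /eqP.
have [n] := ubnP (size b); elim: n => // n IHn in a b N0 * => sbn.
have [//|b0] := eqVneq b 0.
have /andP[/dvdpP[a' ea] /dvdpP[b' eb]] : (P %| a) && (P %| b).
  by apply: small_qnorm_dvd; rewrite ?N0 ?size_poly0 ?(ltnW sM).
have b'0 : b' != 0 by apply: contraNneq b0 => b'0; rewrite eb b'0 mul0r.
suff : b' = 0 by move/eqP; rewrite (negbTE b'0).
apply: (IHn a').
  have /eqP : P ^+ 2 * N a' b' = 0 by rewrite -N0 ea eb /qnorm; ring.
  by rewrite mulf_eq0 expf_eq0 (negbTE (irredp_neq0 hP)) => /eqP.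
have := hP.1; move: sbn; rewrite eb size_mul ?(irredp_neq0 hP) //.
by move: (size b') (size P); lia.
Qed.
End Pell.

(** * Hensel lifting of a square root modulo powers of P *)

Lemma hensel_sqrt (F : fieldType) (P d g : {poly F}) n :
  2%:R != 0 :> F -> irreducible_poly P -> ~~ (P %| d) -> P %| d - g ^+ 2 ->
  exists h : {poly F}, P ^+ n.+1 %| d - h ^+ 2.
Proof.
move=> two0 hP Pd Pg; elim: n => [|n [h /dvdpP[r hr]]]; first by exists g.
have P2h : ~~ (P %| 2%:R *: h).
  rewrite dvdpZr //; apply: contra Pd => Ph.
  rewrite -[d](subrK (h ^+ 2)) hr dvdp_add //.
    by rewrite exprS mulrCA dvdp_mulr.
  by rewrite exprS dvdp_mulr.
have [[u v] /= uv] : exists uv : {poly F} * {poly F},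
    uv.1 * P + uv.2 * (2%:R *: h) = 1.
  by apply/Bezout_eq1_coprimepP; rewrite irreducible_poly_coprime.
(* Newton step: v inverts [2 h] modulo P, so the correction by [v r] cancels r modulo P. *)
exists (h + P ^+ n.+1 * (v * r)).
have e : r - 2%:R * h * v * r = r * u * P.
  have <- : r * (u * P + v * (2%:R *: h)) - 2%:R * h * v * r = r * u * P.
    by rewrite scaler_nat; ring.
  by rewrite uv mulr1.
have -> : d - (h + P ^+ n.+1 * (v * r)) ^+ 2 =
    P ^+ n.+2 * (r * u - P ^+ n * (v * r) ^+ 2).
  transitivity (P ^+ n.+1 * (r - 2%:R * h * v * r) - (P ^+ n.+1 * (v * r)) ^+ 2).
    by rewrite -[d](subrK (h ^+ 2)) hr; ring.
  by rewrite e !exprS; ring.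
by rewrite dvdp_mulr.
Qed.

(** * Fractions of polynomials; F[T] is integrally closed *)

Lemma fracE (R : idomainType) (x : {fraction R}) :
  exists2 uv : R * R, uv.2 != 0 & x = tofrac uv.1 / tofrac uv.2.
Proof.
elim/quotW: x => r; exists (frac r); first exact: denom_ratioP.
have d0 : tofrac (frac r).2 != 0 by rewrite tofrac_eq0; exact: denom_ratioP.
apply: (canRL (mulfK d0)); unlock tofrac; rewrite -[LHS]FracField.pi_mul.
apply/eqmodP; rewrite /= FracField.equivfE /FracField.mulf !numden_Ratio
  ?mulf_neq0 ?oner_eq0 ?denom_ratioP //.
by rewrite !mulr1 mulrC.
Qed.

Section FractionPoly.
Variable F : fieldType.

Lemma frac_coprimeE (x : {fraction {poly F}}) : exists u v : {poly F},
  [/\ v != 0, coprimep v u & x = tofrac u / tofrac v].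
Proof.
have [[u v] /= v0 ->] := fracE x.
have g0 : gcdp u v != 0 by rewrite gcdp_eq0 negb_and v0 orbT.
exists (u %/ gcdp u v), (v %/ gcdp u v); split.
- by rewrite dvdp_div_eq0 ?dvdp_gcdr.
- by rewrite coprimep_sym coprimep_div_gcd // v0 orbT.
have tg0 : tofrac (gcdp u v) != 0 by rewrite tofrac_eq0.
rewrite -[in LHS](divpK (dvdp_gcdl u v)) -[in X in _ / X = _](divpK (dvdp_gcdr u v)).
rewrite !tofracM. by rewrite invfM mulrACA divff // mulr1.
Qed.

Lemma frac_size1 (u v : {poly F}) : size v = 1%N ->
  exists r : {poly F}, tofrac u / tofrac v = tofrac r.
Proof.
move/eqP/size_poly1P => [d d0 ->]; exists (d^-1 *: u).
have td0 : tofrac d%:P != 0 by rewrite tofrac_eq0 polyC_eq0.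
apply: (canLR (mulfK td0)); rewrite -tofracM -scalerAl mulrC mul_polyC.
by rewrite scalerA mulVf // scale1r.
Qed.

(** Rational root argument: with x = u / v in lowest terms, clearing denominators in a monic
    equation of degree n gives [v %| u ^+ n], so v is constant. *)
Lemma frac_poly_integrally_closed (x : {fraction {poly F}}) :
  integralOver (@tofrac {poly F}) x -> exists r, x = tofrac r.
Proof.
have [u [v [v0 cuv ->]]] := frac_coprimeE x.
move=> [p pmon /rootP]; rewrite horner_coef.
have sp : size (map_poly (@tofrac {poly F}) p) = (size p).-1.+1.
  rewrite size_map_poly_id0 ?(monicP pmon) ?tofrac1 ?oner_eq0 //.
  by rewrite prednK // size_poly_gt0 monic_neq0.
rewrite sp; set n := (size p).-1 => e.
have tv0 : tofrac v != 0 by rewrite tofrac_eq0.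
have {}e : \sum_(i < n.+1) p`_i * u ^+ i * v ^+ (n - i) = 0.
  apply/eqP; rewrite -tofrac_eq0 rmorph_sum /=; apply/eqP.
  have {}e := congr1 ( *%R^~ (tofrac v ^+ n)) e; rewrite /= mul0r in e.
  apply: etrans e; rewrite mulr_suml; apply: eq_bigr => i _.
  rewrite coef_map /= !tofracM !tofracXn expr_div_n -!mulrA; congr (_ * (_ * _)).
  have -> : tofrac v ^+ n = tofrac v ^+ i * tofrac v ^+ (n - i).
    by rewrite -exprD subnKC // -ltnS.
  exact/esym/(mulKf (expf_neq0 i tv0)).
apply: frac_size1; apply/eqP; rewrite -dvdp1.
have cvn : coprimep v (u ^+ n) by rewrite coprimep_expr.
have -> : v %| 1 = (v %| u ^+ n * 1) by rewrite (Gauss_dvdpr _ cvn).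
move: e; rewrite mulr1 big_ord_recr /= subnn expr0 mulr1.
have -> : p`_n = 1 by exact: (monicP pmon).
rewrite mul1r addrC => /eqP; rewrite addr_eq0 => /eqP ->.
rewrite dvdpNr; apply: (big_ind (fun y => v %| y)) => [|y z|i _];
  [exact: dvdp0|exact: dvdp_add|].
by rewrite dvdp_mull // -(subnSK (ltn_ord i)) exprS dvdp_mulr.
Qed.
End FractionPoly.

(** * The ring of integers of K = k(s) is F[T] + F[T] s *)

HB.instance Definition _ (R : idomainType) (K : fieldExtType {fraction R}) :=
  GRing.RMorphism.copy (@base_inj R K) (in_alg K \o @tofrac R).

Section QuadraticOrder.
Variables (F : fieldType) (D : {poly F}) (K : fieldExtType {fraction {poly F}}).
Variable s : K.
Hypotheses (two_neq0 : 2%:R != 0 :> F) (hDsf : square_free D)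
  (hs : s ^+ 2 = base_inj K D) (hK : <<1; s>>%VS = fullv)
  (hDnsq : forall a b, qnorm D a b = 0 -> a = 0 /\ b = 0).

Local Notation O := (@integral_closure {poly F} K).
Local Notation iota := (@base_inj {poly F} K).

Definition val2 (a b : {poly F}) : K := iota a + iota b * s.

Lemma base_inj_eq0 a : (iota a == 0) = (a == 0).
Proof. by rewrite fmorph_eq0 tofrac_eq0. Qed.

Lemma val2D a b a' b' : val2 a b + val2 a' b' = val2 (a + a') (b + b').
Proof. by rewrite /val2 !rmorphD /=; ring. Qed.

Lemma val2N a b : - val2 a b = val2 (- a) (- b).
Proof. by rewrite /val2 !rmorphN /=; ring. Qed.

Lemma val2B a b a' b' : val2 a b - val2 a' b' = val2 (a - a') (b - b').
Proof. by rewrite val2N val2D. Qed.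

Lemma val2M a b a' b' :
  val2 a b * val2 a' b' = val2 (a * a' + D * (b * b')) (a * b' + a' * b).
Proof. by rewrite /val2 !rmorphD !rmorphM /= -hs; ring. Qed.

Lemma val2_base a : val2 a 0 = iota a.
Proof. by rewrite /val2 rmorph0 mul0r addr0. Qed.

Lemma val2Z r a b : iota r * val2 a b = val2 (r * a) (r * b).
Proof. by rewrite /val2 !rmorphM /= mulrDr mulrA. Qed.

Lemma val2_conj a b : val2 a b * val2 a (- b) = iota (qnorm D a b).
Proof.
by rewrite val2M -[RHS]val2_base /qnorm; congr val2; ring.
Qed.

Lemma val2_eq0 a b : val2 a b = 0 -> a = 0 /\ b = 0.
Proof.
move=> e; apply: hDnsq; apply/eqP; rewrite -base_inj_eq0.
by rewrite -val2_conj e mul0r.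
Qed.

Lemma val2_inj a b a' b' : val2 a b = val2 a' b' -> a = a' /\ b = b'.
Proof.
move/eqP; rewrite -subr_eq0 val2B => /eqP/val2_eq0[/eqP + /eqP].
by rewrite !subr_eq0 => /eqP-> /eqP->.
Qed.

(** Multiplying by both denominators reduces this to polynomial coordinates, that is, to
    [val2_eq0]. *)
Lemma frac_indep (A B : {fraction {poly F}}) :
  in_alg K A + in_alg K B * s = 0 -> A = 0 /\ B = 0.
Proof.
have [[u v] /= v0 ->] := fracE A; have [[u' v'] /= v'0 ->] := fracE B.
have tv0 : tofrac v != 0 by rewrite tofrac_eq0.
have tv'0 : tofrac v' != 0 by rewrite tofrac_eq0.
move=> e; have [|/eqP + /eqP] := @val2_eq0 (u * v') (u' * v).
  rewrite -[RHS](mulr0 (in_alg K (tofrac v * tofrac v'))) -{}e.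
  have cancel (L : fieldType) (x y z : L) : y != 0 -> y * z * (x / y) = x * z.
    by move=> y0; field.
  rewrite mulrDr mulrA -!(rmorphM (in_alg K)).
  rewrite (cancel _ _ _ _ tv0) [tofrac v * _]mulrC (cancel _ _ _ _ tv'0).
  by rewrite /val2 /base_inj /comp -!tofracM.
rewrite !mulf_eq0 (negbTE v0) (negbTE v'0) !orbF => /eqP-> /eqP->.
by rewrite !tofrac0 !mul0r.
Qed.

Lemma quad_repr (x : K) :
  exists A B : {fraction {poly F}}, x = in_alg K A + in_alg K B * s.
Proof.
have : x \in <<1; s>>%VS by rewrite hK memvf.
case/Fadjoin_polyP => p /polyOver1P[q ->] ->.
elim/poly_ind: q => [|q c [A [B e]]].
  by exists 0, 0; rewrite rmorph0 horner0 !rmorph0 mul0r addr0.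
exists (B * tofrac D + c), A.
rewrite rmorphD rmorphM /= map_polyX map_polyC /= hornerMXaddC e mulrDl -mulrA.
rewrite -expr2 hs /base_inj -!in_algE rmorphD rmorphM /=; ring.
Qed.

(** This stands in for the nontrivial automorphism of K, which is never constructed: it shows that
    the conjugate of a root is a root of the same polynomial. *)
Lemma conj_horner (p : {poly {poly F}}) (A B : {fraction {poly F}}) :
  exists C E : {fraction {poly F}},
  (map_poly iota p).[in_alg K A + in_alg K B * s] = in_alg K C + in_alg K E * s
  /\ (map_poly iota p).[in_alg K A - in_alg K B * s]
      = in_alg K C - in_alg K E * s.
Proof.
elim/poly_ind: p => [|p c [C [E [e e']]]].
  by exists 0, 0; rewrite rmorph0 !horner0 !rmorph0 mul0r addr0 subr0.
exists (C * A + E * B * tofrac D + tofrac c), (C * B + E * A).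
rewrite !rmorphD !rmorphM /= map_polyX map_polyC /= !hornerMXaddC e e'.
have hs' : in_alg K (tofrac D) = s ^+ 2 by rewrite hs.
rewrite -!in_algE hs' /base_inj /comp; split; ring.
Qed.

Lemma integral_base (A : {fraction {poly F}}) :
  O (in_alg K A) -> exists a, A = tofrac a.
Proof.
move=> [p pmon rp]; apply: frac_poly_integrally_closed; exists p => //.
have e : map_poly iota p = map_poly (in_alg K) (map_poly (@tofrac _) p).
  by rewrite -map_poly_comp.
by move: rp; rewrite e fmorph_root.
Qed.

Lemma integralD x y : O x -> O y -> O (x + y).
Proof. exact: (@integral_add _ _ iota). Qed.
Lemma integralM x y : O x -> O y -> O (x * y).
Proof. exact: (@integral_mul _ _ iota). Qed.

Lemma integral_val2 a b : O (val2 a b).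
Proof.
have Oi c : O (iota c) by exact: (@integral_id _ _ iota).
apply: integralD => //; apply: integralM => //.
exists ('X^2 - D%:P); first by rewrite monicXnsubC.
by rewrite rmorphB /= map_polyXn map_polyC /= rootE !hornerE hs subrr.
Qed.

(** The trace 2 A and the norm A^2 - D B^2 are integral elements of k, hence polynomials. As 2 is
    invertible, A is a polynomial; square-freeness of D then removes the denominator of B. *)
Lemma integralP x : O x -> exists a b, x = val2 a b.
Proof.
have [A [B ->]] := quad_repr x => Ox.
have Oc : O (in_alg K A - in_alg K B * s).
  case: Ox => p pmon /rootP rp; exists p => //; apply/rootP.
  have [C [E [e ->]]] := conj_horner p A B.
  have [|-> ->] := @frac_indep C E; first by rewrite -e.
  by rewrite !rmorph0 mul0r subr0.
have [a ea] : exists a, A + A = tofrac a.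
  apply: integral_base; have := integralD Ox Oc.
  by congr (O _); rewrite rmorphD /=; ring.
have {a ea}[a ea] : exists a, A = tofrac a.
  have two_frac : 2%:R != 0 :> {fraction {poly F}}.
    rewrite -(rmorph_nat (@tofrac {poly F})) tofrac_eq0.
    by rewrite -(rmorph_nat (@polyC F)) polyC_eq0.
  exists (2%:R^-1 *: a); apply: (mulfI two_frac).
  rewrite mulr_natl mulr2n ea -(rmorph_nat (@tofrac {poly F})) -tofracM.
  by rewrite -(rmorph_nat (@polyC F)) mul_polyC scalerA mulfV // scale1r.
have [n en] : exists n, A ^+ 2 - tofrac D * B ^+ 2 = tofrac n.
  apply: integral_base; have := integralM Ox Oc.
  have hs' : in_alg K (tofrac D) = s ^+ 2 by rewrite hs.
  have -> : in_alg K (A ^+ 2 - tofrac D * B ^+ 2)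
      = in_alg K A ^+ 2 - in_alg K (tofrac D) * in_alg K B ^+ 2.
    by rewrite !expr2 !(rmorphB (in_alg K), rmorphM (in_alg K)).
  by rewrite hs'; congr (O _); ring.
have [u [v [v0 cuv eB]]] := frac_coprimeE B.
have tv0 : tofrac v != 0 by rewrite tofrac_eq0.
have e : D * u ^+ 2 = (a ^+ 2 - n) * v ^+ 2.
  apply/eqP; rewrite -tofrac_eq; apply/eqP.
  have clear (L : fieldType) (w d y z : L) : z != 0 ->
      d * (y * y) = (w * w - (w ^+ 2 - d * (y / z) ^+ 2)) * (z * z).
    by move=> z0; field.
  rewrite !expr2 !tofracM tofracB tofracM -ea -en eB; exact: clear.
(* [v^2] divides [D u^2] and is prime to [u^2], so it divides D. *)
have sv : size v = 1%N.
  apply/eqP; apply: contraT => /hDsf.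
  have c2 : coprimep (v ^+ 2) (u ^+ 2) by rewrite coprimep_expl // coprimep_expr.
  by rewrite -(Gauss_dvdpl D c2) e dvdp_mull.
have [b eb] := frac_size1 u sv.
by exists a, b; rewrite eB ea eb.
Qed.

End QuadraticOrder.

(** * Ideals and their classes *)

Section IdealClasses.
Variables (R : idomainType) (K : fieldExtType {fraction R}).
Local Open Scope classical_set_scope.
Local Notation O := (@integral_closure R K).

(** The part of [fractional_ideal] that suffices to compare classes; it is stable under scaling by
    any x, zero included. *)
Definition omodule (I : set K) : Prop :=
  [/\ I 0, (forall x y, I x -> I y -> I (x + y))
    & (forall a x, O a -> I x -> I (a * x))].

Lemma fractional_omodule I : fractional_ideal I -> omodule I.
Proof. by case. Qed.

Lemma integral_closure1 : O 1.
Proof. exact: (@integral1 _ _ (@base_inj R K)). Qed.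

Lemma omoduleB I x y : omodule I -> I x -> I y -> I (x - y).
Proof.
move=> [_ ID IM] Ix Iy; apply: ID => //; rewrite -mulN1r; apply: IM => //.
exact/(@integral_opp _ _ (@base_inj R K))/integral_closure1.
Qed.

Definition scale_ideal (x : K) (I : set K) : set K := [set x * w | w in I].

Lemma scale_omodule x I : omodule I -> omodule (scale_ideal x I).
Proof.
move=> [I0 ID IM]; split; first by exists 0; rewrite ?mulr0.
- by move=> _ _ [u Iu <-] [v Iv <-]; exists (u + v); rewrite ?mulrDr//; exact: ID.
- by move=> a _ Oa [u Iu <-]; exists (a * u); rewrite 1?mulrCA//; exact: IM.
Qed.

(** The finite sums in [ideal_mul] bring nothing new, since I absorbs O and is closed under
    addition. Classes can then be handled by plain scaling. *)
Lemma ideal_mul_principal x I : omodule I ->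
  ideal_mul (principal_ideal x) I = scale_ideal x I.
Proof.
move=> mI; rewrite eqEsubset; split=> z /=; last first.
  case=> w Iw <-; exists 1%N, (fun=> x), (fun=> w); rewrite big_ord1; split=> //.
  by move=> _; split=> //; exists 1; rewrite ?mul1r //; exact: integral_closure1.
have [S0 SD SM] := scale_omodule x mI.
case=> n [a [b [ab ->]]]; apply: (big_ind (scale_ideal x I)) => // i _.
have [[o Oo <-] Ib] := ab i; rewrite -mulrA; apply: SM => //; by exists (b i).
Qed.

Lemma ideal_class_scale z I : omodule I -> z != 0 ->
  ideal_class (scale_ideal z I) = ideal_class I.
Proof.
move=> mI z0; rewrite eqEsubset; split=> J [y /= y0 <-].
  exists (y * z) => /=; first exact: mulf_neq0.
  rewrite !ideal_mul_principal //; last exact: scale_omodule.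
  rewrite eqEsubset; split=> w /=.
    by case=> v Iv <-; exists (z * v); rewrite ?mulrA //; exists v.
  by case=> _ [v Iv <-] <-; exists v; rewrite ?mulrA.
exists (y / z) => /=; first by rewrite mulf_neq0 ?invr_eq0.
rewrite !ideal_mul_principal //; last exact: scale_omodule.
rewrite eqEsubset; split=> w /=.
  by case=> _ [v Iv <-] <-; exists v; rewrite ?mulrA ?divfK.
by case=> v Iv <-; exists (z * v); rewrite ?mulrA ?divfK //; exists v.
Qed.

(** I lies in its own class, with scalar 1, hence in the class of J. *)
Lemma ideal_class_eq I J : omodule I -> omodule J ->
  ideal_class I = ideal_class J -> exists y, I = scale_ideal y J.
Proof.
move=> mI mJ eIJ; have : ideal_class I I.
  exists 1; [exact: oner_neq0|rewrite ideal_mul_principal //].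
  by rewrite /scale_ideal; under eq_fun do rewrite mul1r; rewrite image_id.
by rewrite eIJ => -[y _ <-]; exists y; rewrite ideal_mul_principal.
Qed.
End IdealClasses.

(** * Finiteness of the class group *)

Lemma small_residue (F : finFieldType) (n v : {poly F}) (m : nat) : n != 0 ->
  exists t : {poly F},
    [/\ t != 0, (size t <= m.+1)%N & (size ((t * v) %% n)%R <= (size n).-1 - m)%N].
Proof.
move=> n0; set k := ((size n).-1 - m)%N.
(* Box principle: q^(m+1) polynomials w against q^m values for the m coefficients of [w v %% n] from
   degree k on. The difference of two colliding w is t. *)
pose f (w : 'rV[F]_m.+1) : 'rV[F]_m := \row_j ((rVpoly w * v) %% n)`_(k + j).
have /injectivePn[w [w' ww' fww']] : ~~ injectiveb f.
  apply/negP => /injectiveP /leq_card; rewrite !card_mx !mul1n leq_exp2l.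
    by rewrite ltnn.
  exact: finRing_gt1.
exists (rVpoly (w - w')); split; last 1 first.
- apply/leq_sizeP => j kj; have [jn|nj] := ltnP j (size n).-1; last first.
    by apply: nth_default; apply: leq_trans nj; rewrite -ltnS prednK
      ?size_poly_gt0 // ltn_modp.
  have jkm : (j - k < m)%N by move: jn kj; rewrite /k; lia.
  move/rowP: fww' => /(_ (Ordinal jkm)); rewrite !mxE /= subnKC // => e.
  rewrite linearB /= mulrBl -[- _ in X in X %% _]scaleN1r modpD modpZl scaleN1r.
  by rewrite coefB e subrr.
- apply: contra ww' => /eqP e; rewrite -subr_eq0 -[w - w']rVpolyK e.
  by rewrite linear0.
- exact: size_poly.
Qed.
Section Finiteness.
Variables (F : finFieldType) (D : {poly F}) (m : nat).
Variables (K : fieldExtType {fraction {poly F}}) (s : K).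
Hypotheses (two_neq0 : 2%:R != 0 :> F) (hDsf : square_free D)
  (hs : s ^+ 2 = base_inj K D) (hK : <<1; s>>%VS = fullv)
  (hDnsq : forall a b, qnorm D a b = 0 -> a = 0 /\ b = 0)
  (hDm : (size D <= m.*2.+1)%N).
Local Open Scope classical_set_scope.

Local Notation O := (@integral_closure {poly F} K).
Local Notation iota := (@base_inj {poly F} K).
Local Notation val2 := (val2 s).

Let OP x : O x -> exists a b, x = val2 a b :=
  fun h => integralP two_neq0 hDsf hs hK hDnsq h.
Let valO a b : O (val2 a b) := integral_val2 hs a b.

(** As deg D is at most 2 m, the stronger bound on [r2] absorbs the factor D, and the norm has
    degree at most 2 deg n - 2. This is the remainder bound of a Euclidean division. *)
Lemma qnorm_le_lt (n r1 r2 y : {poly F}) :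
  (size r1 < size n)%N -> (size r2 <= (size n).-1 - m)%N ->
  y * n = qnorm D r1 r2 -> (size y < size n)%N.
Proof.
move=> s1 s2 e; have [->|y0] := eqVneq y 0.
  by rewrite size_poly0; apply: leq_ltn_trans s1.
have n0 : n != 0 by rewrite -size_poly_gt0; apply: leq_ltn_trans s1.
have : (size (y * n)%R <= (size n).*2 - 3)%N.
  rewrite e (leq_trans (size_polyD _ _)) // size_polyN geq_max; apply/andP; split.
    rewrite expr2 (leq_trans (size_polyMleq _ _)) //.
    by move: (size r1) (size n) s1; lia.
  have [->|r20] := eqVneq r2 0; first by rewrite expr0n mulr0 size_poly0.
  rewrite expr2 (leq_trans (size_polyMleq _ _)) // size_mul //.
  move: r20; rewrite -size_poly_gt0.
  by move: (size r2) (size D) (size n) s2 hDm; lia.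
rewrite size_mul //; move: y0 n0; rewrite -!size_poly_gt0.
by move: (size y) (size n); lia.
Qed.

(** A common multiple of all the t that [small_residue] can produce, so that one polynomial serves
    every ideal. *)
Definition small_multiplier : {poly F} :=
  \prod_(w : 'rV[F]_m.+1 | rVpoly w != 0) rVpoly w.

Lemma small_multiplier_neq0 : small_multiplier != 0.
Proof. by apply/prodf_neq0. Qed.

Lemma dvdp_small_multiplier (t : {poly F}) :
  t != 0 -> (size t <= m.+1)%N -> t %| small_multiplier.
Proof.
move=> t0 st; have e : rVpoly (poly_rV t : 'rV_m.+1) = t by rewrite poly_rV_K.
rewrite /small_multiplier (bigD1 (poly_rV t)) ?e //=.
by rewrite dvdp_mulr.
Qed.

(* An element x of least norm in I plays the role of a generator: division by x
   works after multiplication by a polynomial t of degree at most m. *)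
Lemma ideal_reduction (I : set K) : fractional_ideal I ->
  exists2 z, z != 0 & scale_ideal z I `<=` O
    /\ scale_ideal z I (iota small_multiplier).
Proof.
move=> fI; have [_ _ _ [i Ii i0] [d [Od d0 dI]]] := fI.
have [J0 JD JM] := scale_omodule d (fractional_omodule fI).
set J := scale_ideal d I in J0 JD JM.
have JO x : J x -> O x by case=> w Iw <-; apply: dI.
pose Q n := `[< exists a b, [/\ J (val2 a b), val2 a b != 0
  & size (qnorm D a b) = n] >].
have exQ : exists n, Q n.
  have [a [b e]] := OP (dI _ Ii).
  exists (size (qnorm D a b)); apply/asboolP; exists a, b; rewrite -e.
  by split=> //; [exists i|rewrite mulf_neq0].
case: (ex_minnP exQ) => _ /asboolP[a [b [Jx x0 <-]]] xmin.
set x := val2 a b in Jx x0; set n := qnorm D a b.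
have n0 : n != 0.
  apply: contraNneq x0 => /hDnsq[a0 b0].
  by rewrite /x a0 b0 val2_base rmorph0.
have tz0 : iota small_multiplier != 0.
  by rewrite base_inj_eq0 small_multiplier_neq0.
(* Scaling I by this sends the element of I that d carries to x to [small_multiplier] itself. *)
exists (iota small_multiplier / x * d); first by rewrite !mulf_neq0 ?invr_eq0.
split; last first.
  case: Jx => w Iw dw; exists w => //.
  by rewrite -[LHS]mulrA dw divfK.
move=> _ [w Iw <-]; rewrite -[_ * w]mulrA; set y := d * w.
have Jy : J y by exists w.
have [u [v ey]] := OP (JO _ Jy).
(* The coordinates of y / x are [(u a - D v b) / n] and [(v a - u b) / n]; t is chosen to make the
   remainder of the second one small. *)
have [t [t0 st sr]] := small_residue (v * a - u * b) m n0.
set r2 := (t * _) %% n in sr.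
pose c1 := t * (u * a - D * (v * b)).
pose r1 := c1 %% n.
pose q1 := c1 %/ n; pose q2 := (t * (v * a - u * b)) %/ n.
have e1 : c1 = q1 * n + r1 by exact: divp_eq.
have e2 : t * (v * a - u * b) = q2 * n + r2 by exact: divp_eq.
pose y1 := t * u - (q1 * a + D * (q2 * b)).
pose y2 := t * v - (q1 * b + a * q2).
have ey12 : val2 y1 y2 = iota t * y - val2 q1 q2 * x.
  by rewrite ey /x (val2M hs) val2Z val2B.
(* The remainder [t y - q x] times the conjugate of x is [r1 + r2 sqrt D]; take norms. *)
have yxr : qnorm D y1 y2 * n = qnorm D r1 r2.
  have r1E : r1 = y1 * a - D * (y2 * b).
    rewrite (_ : r1 = c1 - q1 * n); last by rewrite e1; ring.
    by rewrite /c1 /n /y1 /y2 /qnorm; ring.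
  have r2E : r2 = y2 * a - y1 * b.
    rewrite (_ : r2 = t * (v * a - u * b) - q2 * n); last by rewrite e2; ring.
    by rewrite /n /y1 /y2 /qnorm; ring.
  by rewrite r1E r2E /n /qnorm; ring.
have Jy12 : J (val2 y1 y2).
  rewrite ey12; apply: (@omoduleB _ _ J) => //.
    by rewrite -(val2_base s); exact: JM.
  exact: JM.
(* A nonzero remainder would be an element of J of smaller norm than x. *)
have y12 : val2 y1 y2 = 0.
  apply/eqP; apply: contraT => y120.
  have /xmin : Q (size (qnorm D y1 y2)) by apply/asboolP; exists y1, y2.
  by rewrite leqNgt (qnorm_le_lt _ sr yxr) // ltn_modp.
have ty : iota t * y = val2 q1 q2 * x.
  by apply/eqP; rewrite -subr_eq0 -ey12 y12.
have /dvdpP[t' ->] := dvdp_small_multiplier t0 st.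
rewrite rmorphM /= mulrAC -(mulrA (iota t')) ty mulrA mulfK //.
by rewrite -(val2_base s) (val2M hs).
Qed.

(** An ideal inside O that contains T is a union of cosets of T O, so the residue pairs modulo T
    that it contains determine it. For other sets S, [dec S] may fail to be an ideal, but only a
    finite superset of the classes is wanted. *)
Lemma class_group_finite : finite_set (@class_group {poly F} K).
Proof.
set T := small_multiplier; set n := size T.
have T0 : T != 0 := small_multiplier_neq0.
pose dec (S : {set 'rV[F]_n * 'rV[F]_n}) : set K := [set w | exists ab,
  exists2 o, ab \in S /\ O o & w = val2 (rVpoly ab.1) (rVpoly ab.2) + iota T * o].
apply: (@sub_finite_set _ _ [set ideal_class (dec S) | S in setT]); last first.
  exact/finite_image/finite_finset.
move=> _ [I fI <-]; have [z z0 [zO zT]] := ideal_reduction fI.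
have mI := fractional_omodule fI; have mJ := scale_omodule z mI.
have [_ JD JM] := mJ.
set J := scale_ideal z I in zO zT mJ JD JM.
exists [set ab | `[< J (val2 (rVpoly ab.1) (rVpoly ab.2)) >]]%SET => //.
rewrite -(ideal_class_scale mI z0); congr ideal_class.
rewrite eqEsubset; split=> w /=.
  case=> ab [o [+ Oo] ->]; rewrite inE => /asboolP Jab.
  by apply: JD => //; rewrite mulrC; apply: JM.
move=> Jw; have [a [b ew]] := OP (zO _ Jw).
have e : w = val2 (a %% T) (b %% T) + iota T * val2 (a %/ T) (b %/ T).
  rewrite val2Z val2D ew {1}(divp_eq a T) {1}(divp_eq b T).
  by congr val2; ring.
have sm c : (size (c %% T)%R <= n)%N by rewrite ltnW // ltn_modp.
exists (poly_rV (a %% T), poly_rV (b %% T)), (val2 (a %/ T) (b %/ T)).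
  split=> //; rewrite inE /= !poly_rV_K //; apply/asboolP.
  have -> : val2 (a %% T) (b %% T) = w - val2 (a %/ T) (b %/ T) * iota T.
    by rewrite e; ring.
  by apply: omoduleB => //; exact: JM.
by rewrite /= !poly_rV_K.
Qed.
End Finiteness.

(** * Powers of a prime above P and their classes *)

Section PrimeIdealPowers.
Variables (F : fieldType) (P M : {poly F}) (c : F).
Local Notation D := (M ^+ 2 + c%:P).
Variables (K : fieldExtType {fraction {poly F}}) (s : K).
Hypotheses (two_neq0 : 2%:R != 0 :> F) (hDsf : square_free D)
  (hs : s ^+ 2 = base_inj K D) (hK : <<1; s>>%VS = fullv)
  (hP : irreducible_poly P) (hPM : P %| M) (hc : c != 0)
  (hM : (1 < size M)%N).
Variables (g : {poly F}) (L : nat).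
Hypothesis (hg : P ^+ L %| D - g ^+ 2).
Local Open Scope classical_set_scope.

Local Notation O := (@integral_closure {poly F} K).
Local Notation iota := (@base_inj {poly F} K).
Local Notation val2 := (val2 s).

Let P0 : P != 0 := irredp_neq0 hP.

Let hDnsq a b (h : qnorm D a b = 0) : a = 0 /\ b = 0 :=
  qnorm_eq0 hP hPM hc two_neq0 hM h.

Let OP x : O x -> exists a b, x = val2 a b :=
  fun h => integralP two_neq0 hDsf hs hK hDnsq h.
Let valO a b : O (val2 a b) := integral_val2 hs a b.
Let inj2 a b a' b' (h : val2 a b = val2 a' b') : a = a' /\ b = b' :=
  val2_inj hs hDnsq h.

(* The k-th power of the prime (P, sqrt D - g), as the preimage of P^k under the
   ring morphism sending sqrt D to g modulo P^L; hence only for k <= L. *)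
Definition prime_power (k : nat) : set K :=
  [set x | exists a b, x = val2 a b /\ P ^+ k %| a + b * g].

Lemma dvdp_sqrt k : (k <= L)%N -> P ^+ k %| D - g ^+ 2.
Proof. by move=> kL; apply: dvdp_trans hg; apply: dvdp_exp2l. Qed.

(** Sending sqrt D to g is multiplicative modulo [D - g^2], which [P^(k + l)] divides. *)
Lemma prime_power_mul k l x y : (k + l <= L)%N ->
  prime_power k x -> prime_power l y -> prime_power (k + l) (x * y).
Proof.
move=> klL [a [b [-> ab]]] [a' [b' [-> ab']]].
rewrite (val2M hs); do 2 eexists; split; first by [].
have -> : a * a' + D * (b * b') + (a * b' + a' * b) * g =
    (a + b * g) * (a' + b' * g) + b * b' * (D - g ^+ 2) by ring.
apply: dvdp_add; first by rewrite exprD dvdp_mul.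
by rewrite dvdp_mull // dvdp_sqrt.
Qed.

Lemma prime_power_base k : prime_power k (iota (P ^+ k)).
Proof.
exists (P ^+ k), 0; split; first by rewrite (val2_base s).
by rewrite mul0r addr0.
Qed.

Lemma prime_power_root k : prime_power k (val2 (- g) 1).
Proof. by exists (- g), 1; rewrite mul1r addNr dvdp0. Qed.

Lemma prime_power_integral k : prime_power k `<=` O.
Proof. by move=> _ [a [b [-> _]]]. Qed.

Lemma prime_power_fractional k : (k <= L)%N -> fractional_ideal (prime_power k).
Proof.
move=> kL; split.
- exists 0, 0; split; first by rewrite (val2_base s) rmorph0.
  by rewrite mul0r addr0 dvdp0.
- move=> _ _ [a [b [-> ab]]] [a' [b' [-> ab']]]; rewrite val2D.
  exists (a + a'), (b + b'); split=> //.
  by rewrite mulrDl addrACA dvdp_add.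
- move=> _ x /OP[a [b ->]] Ix; rewrite -(add0n k); apply: prime_power_mul => //.
  by exists a, b; rewrite expr0 dvd1p.
- exists (iota (P ^+ k)); first exact: prime_power_base.
  by rewrite base_inj_eq0 expf_neq0.
exists 1; split; [exact: integral_closure1|exact: oner_neq0|].
by move=> x /prime_power_integral; rewrite mul1r.
Qed.

Lemma irredp_ndvd_sqrt : (0 < L)%N -> ~~ (P %| g).
Proof.
move=> L0; apply: contra (irredp_ndvdD hP hPM hc) => Pg.
rewrite -[D](subrK (g ^+ 2)) dvdp_add //.
  by have := dvdp_sqrt L0; rewrite expr1.
by rewrite exprS dvdp_mulr.
Qed.

Lemma coprimep_irredpX k (a : {poly F}) : ~~ (P %| a) -> coprimep (P ^+ k) a.
Proof. by move=> Pa; rewrite coprimep_expl // irreducible_poly_coprime. Qed.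

Lemma qnorm_val2M a b a' b' u v : val2 a b * val2 a' b' = val2 u v ->
  qnorm D a b * qnorm D a' b' = qnorm D u v.
Proof. by rewrite (val2M hs) => /inj2[<- <-]; rewrite /qnorm; ring. Qed.

Section Equivalence.
Variables (i j : nat) (y : K).
Hypotheses (ltij : (i < j)%N) (ltjL : (j < L)%N)
  (hy : prime_power i = scale_ideal y (prime_power j)).

(** The element a + b sqrt D is the inverse of y, and the point is its integrality. Writing P^i = y
    w, this inverse is w / P^i, and P^i turns out to divide both coordinates of w. *)
Lemma prime_power_quotient : exists a b : {poly F},
  (forall u, prime_power i u -> prime_power j (val2 a b * u))
  /\ (forall v, prime_power j v ->
        exists2 u, prime_power i u & v = val2 a b * u).
Proof.
have [w [Jw yw]] : exists w, prime_power j w /\ y * w = iota (P ^+ i).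
  have := prime_power_base i; rewrite hy => -[w Jw e]; by exists w.
have Pi0 : iota (P ^+ i) != 0 by rewrite base_inj_eq0 expf_neq0.
have w_mul v : w * (y * v) = iota (P ^+ i) * v by rewrite -yw; ring.
have [a [b [ew Pab]]] := Jw.
have Pg : ~~ (P %| g) by apply: irredp_ndvd_sqrt; apply: leq_ltn_trans ltjL.
have Piab : P ^+ i %| a + b * g.
  by apply: dvdp_trans Pab; apply: dvdp_exp2l; exact: ltnW.
(* Write -g + sqrt D = y v. Then w (-g + sqrt D) = P^i v, and the coordinate of the left side at
   sqrt D is [a - b g]. *)
have Piab' : P ^+ i %| a - b * g.
  have := prime_power_root i; rewrite {1}hy => -[v /prime_power_integral/OP[e [f ->]] ev].
  have := w_mul (val2 e f); rewrite ev ew (val2M hs) val2Z => /inj2[_ e1].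
  by rewrite (_ : a - b * g = P ^+ i * f) ?dvdp_mulr // -e1; ring.
have /dvdpP[b1 eb] : P ^+ i %| b.
  rewrite -(Gauss_dvdpl b (coprimep_irredpX i Pg)) -(dvdpZr _ _ two_neq0).
  have -> : 2%:R *: (b * g) = (a + b * g) - (a - b * g).
    by rewrite scaler_nat; ring.
  by rewrite dvdp_sub.
have /dvdpP[a1 ea] : P ^+ i %| a.
  by rewrite -[a](addrK (b * g)) dvdp_sub // eb mulrAC dvdp_mull.
exists a1, b1.
have w1 : w = iota (P ^+ i) * val2 a1 b1.
  by rewrite ew val2Z ea eb; congr val2; rewrite mulrC.
split=> [u|v Jv].
  rewrite {1}hy => -[v Jv <-]; suff -> : val2 a1 b1 * (y * v) = v by [].
  by apply: (mulfI Pi0); rewrite mulrA -w1 w_mul.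
exists (y * v); first by rewrite hy; exists v.
by apply: (mulfI Pi0); rewrite mulrA -w1 w_mul.
Qed.

(** The inverse of y carries the i-th power onto the j-th, so its norm is P^(j - i) up to a
    constant. It is not divisible by P, contrary to [small_qnorm_dvd]. *)
Lemma prime_power_inequiv : (size (P ^+ (j - i))%R < size M)%N -> False.
Proof.
move=> small; have [a [b [toJ fromI]]] := prime_power_quotient.
have ji1 : (0 < j - i)%N by rewrite subn_gt0.
(* The element -g + sqrt D of the j-th power is a multiple of a + b sqrt D and has a coordinate
   equal to 1. *)
have primitive : ~~ ((P %| a) && (P %| b)).
  apply/negP => /andP[/dvdpP[a' ea] /dvdpP[b' eb]].
  have [u /prime_power_integral/OP[e [f ->]]] := fromI _ (prime_power_root j).
  rewrite (val2M hs) => /inj2[_ e1].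
  have : P %| 1 by rewrite e1 ea eb; apply/dvdpP; exists (a' * f + e * b'); ring.
  by rewrite dvdp1 => /eqP P1; have := hP.1; rewrite P1.
have Pab : P ^+ (j - i) %| a + b * g.
  have [e [f []]] := toJ _ (prime_power_base i).
  rewrite -(val2_base s) (val2M hs) => /inj2[<- <-].
  rewrite !(mulr0, addr0, add0r) => h.
  have Pi0 : P ^+ i != 0 by exact: expf_neq0.
  rewrite -(dvdp_mul2l _ _ Pi0) -exprD subnKC; last exact: ltnW.
  by apply: etrans h; congr (_ %| _); ring.
have normE : qnorm D a b
    = (a + b * g) * (a - b * g) - b ^+ 2 * (D - g ^+ 2).
  by rewrite /qnorm; ring.
have PjN : P ^+ (j - i) %| qnorm D a b.
  rewrite normE; apply: dvdp_sub; first by rewrite dvdp_mulr.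
  by rewrite dvdp_mull // dvdp_sqrt // (leq_trans (leq_subr _ _)) // ltnW.
(* Otherwise [P^(j - i + 1)] divides [a + b g], because [a - b g] is prime to P; then P^j would lie
   in the (j + 1)-th power. *)
have NPjN : ~~ (P ^+ (j - i).+1 %| qnorm D a b).
  apply/negP => PN.
  have jiL : ((j - i).+1 <= L)%N by apply: leq_trans ltjL; rewrite ltnS leq_subr.
  have Nab' : ~~ (P %| a - b * g).
    apply: contra primitive => Pab'.
    have Pab1 : P %| a + b * g.
      by apply: dvdp_trans Pab; rewrite -{1}[P]expr1 dvdp_exp2l.
    have Pg : ~~ (P %| g) by apply: irredp_ndvd_sqrt; apply: leq_ltn_trans ltjL.
    have Pb : P %| b.
      have : P %| 2%:R *: (b * g).
        have -> : 2%:R *: (b * g) = (a + b * g) - (a - b * g).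
          by rewrite scaler_nat; ring.
        by rewrite dvdp_sub.
      by rewrite dvdpZr // (irredp_dvdM hP) (negbTE Pg) orbF.
    by rewrite Pb andbT -[a](addrK (b * g)) dvdp_sub // dvdp_mulr.
  have Pab1 : P ^+ (j - i).+1 %| a + b * g.
    rewrite -(Gauss_dvdpl _ (coprimep_irredpX _ Nab')).
    by move: PN; rewrite normE dvdp_subl // dvdp_mull // dvdp_sqrt.
  have [u Iu] := fromI _ (prime_power_base j).
  have e : ((j - i).+1 + i)%N = j.+1 by rewrite addSn subnK // ltnW.
  have : prime_power j.+1 (val2 a b * u).
    rewrite -e; apply: prime_power_mul => //; first by rewrite e.
    by exists a, b.
  move=> + eu; rewrite -eu => -[e1 [f1 []]].
  rewrite -(val2_base s) => /inj2[<- <-]; rewrite mul0r addr0.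
  rewrite dvdp_Pexp2l ?ltnn //; exact: hP.1.
have /dvdpP[r er] := PjN.
have Pr : ~~ (P %| r).
  by apply: contra NPjN => Pr; rewrite er exprS dvdp_mul.
(* The norm of a + b sqrt D divides that of P^j, which is P^(2 j), and r is prime to P. *)
have sr : size r = 1%N.
  have [u /prime_power_integral/OP[e [f ->]]] := fromI _ (prime_power_base j).
  rewrite -(val2_base s) => /esym/qnorm_val2M eN.
  apply/eqP; rewrite -dvdp1.
  have crP : coprimep r ((P ^+ j) ^+ 2).
    by rewrite -exprM coprimep_sym coprimep_irredpX.
  have -> : (r %| 1) = (r %| (P ^+ j) ^+ 2 * 1) by rewrite (Gauss_dvdpr _ crP).
  have -> : (P ^+ j) ^+ 2 * 1 = qnorm D (P ^+ j) 0.
    by rewrite /qnorm expr0n mulr0 subr0 mulr1.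
  by rewrite -eN er dvdp_mulr // dvdp_mulr.
apply/negP: primitive; rewrite negbK.
apply: (small_qnorm_dvd hP hPM hc two_neq0 hM); last first.
  by apply: dvdp_trans PjN; rewrite -{1}[P]expr1 dvdp_exp2l.
by move/eqP/size_poly1P: sr er => [d d0 ->] ->; rewrite mul_polyC size_scale.
Qed.
End Equivalence.
End PrimeIdealPowers.

(** * Counting the classes *)

Lemma odd_pchar_two_neq0 (F : fieldType) p :
  odd p -> p \in [pchar F] -> 2%:R != 0 :> F.
Proof.
move=> op /pcharf0 e; apply/negP => /eqP two0; move: e.
rewrite -(odd_double_half p) op -muln2 natrD natrM two0 mulr0 addr0.
by move/eqP; rewrite oner_eq0.
Qed.

Lemma leq_card_fset_set (T : choiceType) (A : set T) n (f : nat -> T) :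
  finite_set A -> (forall i, (i < n)%N -> A (f i)) ->
  {in gtn n &, injective f} -> (n <= #|` fset_set A|)%N.
Proof.
move=> finA fA finj; rewrite -{1}(size_iota 0 n) -(size_map f).
apply: uniq_leq_size.
  rewrite map_inj_in_uniq ?iota_uniq // => i j.
  by rewrite !mem_iota /= !add0n; apply: finj.
move=> _ /mapP[i + ->]; rewrite mem_iota add0n /= => /fA Ai.
by rewrite in_fset_set // inE.
Qed.

Theorem corollary1 (p e : nat) (hp : prime p) (hp_odd : odd p)
  (F : finFieldType) (hF : #|F| = (p ^ e)%N)
  (P G : {poly F}) (c : F)
  (hP : irreducible_poly P) (hc : c != 0) (hG : (2 <= deg G)%N)
  (D : {poly F}) (hD : D = (P * G) ^+ 2 + c%:P)
  (hDsf : square_free D) (hDmonic : D \is monic)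
  (K : fieldExtType {fraction {poly F}}) (sqrtD : K)
  (hsqrtD : sqrtD ^+ 2 = base_inj K D)
  (hK : <<1; sqrtD>>%VS = fullv)
  (hcP : quad_res c%:P P = 1) :
  ((deg (G * P))%:R / (deg P)%:R : rat) <= (class_number K)%:R /\
  1 < ((deg (G * P))%:R / (deg P)%:R : rat).
Proof.
have two0 := odd_pchar_two_neq0 hp_odd (card_finPcharP hF hp).
have P0 := irredp_neq0 hP.
have dP : (0 < deg P)%N by have := hP.1; rewrite /deg; case: (size P) => [|[]].
have G0 : G != 0 by apply: contraTneq hG => ->; rewrite /deg size_poly0.
have dGP : deg (G * P) = (deg G + deg P)%N.
  rewrite /deg size_mul //; move: P0 G0; rewrite -!size_poly_gt0.
  by move: (size P) (size G); lia.
have dP0 : 0 < (deg P)%:R :> rat by rewrite ltr0n.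
split; last by rewrite ltr_pdivlMr // mul1r ltr_nat dGP -{1}[deg P]add0n ltn_add2r ltnW.
set M := P * G in hD; have sM : size M = (deg (G * P)).+1.
  by rewrite /deg mulrC prednK // size_poly_gt0 mulf_neq0.
have M1 : (1 < size M)%N by rewrite sM dGP ltnS addn_gt0 dP orbT.
have PM : P %| M by rewrite dvdp_mulr.
have hnsq a b : qnorm D a b = 0 -> a = 0 /\ b = 0.
  by rewrite hD; apply: (qnorm_eq0 hP PM hc two0 M1).
have sD : (size D <= (deg (G * P)).*2.+1)%N.
  rewrite hD (leq_trans (size_polyD _ _)) // geq_max; apply/andP; split.
    rewrite expr2 (leq_trans (size_polyMleq _ _)) // sM.
    by rewrite addSn addnS -addnn.
  by rewrite size_polyC hc.
have finC := class_group_finite two0 hDsf hsqrtD hK hnsq sD.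
(* This is deg (G P) / deg P rounded up; the exponents 0, ..., n - 1 will give n distinct
   classes. *)
pose n := ((deg (G * P)).-1 %/ deg P).+1.
(* D is congruent to c modulo P, so a square root of c modulo P is one of D and can be lifted. *)
have [h Ph] : exists h, P ^+ n.+1 %| D - h ^+ 2.
  have [g Pg] : exists g, P %| c%:P - g ^+ 2.
    by move: hcP; rewrite /quad_res; case: ifP => // _; case: asboolP.
  apply: (hensel_sqrt (g := g)) => //.
    by rewrite hD; exact: (irredp_ndvdD hP PM hc).
  by rewrite hD -addrA dvdp_add // exprS dvdp_mulr.
have dn : (deg (G * P) <= n * deg P)%N.
  rewrite -(ltn_predK (_ : 0 < deg (G * P))%N) ?ltn_ceil //.
  by rewrite dGP addn_gt0 dP orbT.
suff hn : (n <= class_number K)%N.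
  rewrite ler_pdivrMr // -natrM ler_nat (leq_trans dn) // leq_mul2r.
  by rewrite hn orbT.
subst D.
pose I k := prime_power P sqrtD h k.
have fI k : (k <= n)%N -> fractional_ideal (I k).
  move=> kn; apply: (prime_power_fractional two0 hDsf hsqrtD hK hP PM hc M1 Ph).
  exact: leqW.
apply: (leq_card_fset_set (f := fun k => ideal_class (I k))) => //.
  by move=> k /ltnW/fI fIk; exists (I k).
have distinct i j : (i < j)%N -> (j < n)%N ->
    ideal_class (I i) = ideal_class (I j) -> False.
  move=> ij jn eIJ; have im := ltn_trans ij jn.
  have mI k (kn : (k < n)%N) := fractional_omodule (fI k (ltnW kn)).
  have [y ey] := ideal_class_eq (mI _ im) (mI _ jn) eIJ.
  have jL : (j < n.+1)%N by rewrite ltnS ltnW.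
  apply: (prime_power_inequiv two0 hDsf hsqrtD hK hP PM hc M1 Ph ij jL ey).
  have -> : size (P ^+ (j - i)) = ((j - i) * deg P).+1.
    by rewrite mulnC -size_exp prednK // size_poly_gt0 expf_neq0.
  (* By the rounding in n, [(n - 1) deg P] is at most deg (G P) - 1, which is less than deg M. *)
  rewrite sM ltnS (leq_ltn_trans (_ : _ <= n.-1 * deg P)%N) //.
    by rewrite leq_mul2r /= -ltnS (leq_ltn_trans (leq_subr _ _)) ?orbT.
  rewrite (leq_ltn_trans (leq_trunc_div _ _)) // prednK //.
  by rewrite dGP addn_gt0 dP orbT.
move=> i j; rewrite !inE => im jm eIJ.
have [/distinct|/distinct|//] := ltngtP i j; first by move/(_ jm eIJ).
by move/(_ im (esym eIJ)).
Qed.
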